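(* Let $P$ be a finite (naturally labeled) poset with a unique maximal element $\hat 1$ and let $1 \le k < \mathrm{ht}(P)$. Then $$h^*\big(\Delta'(P,k+1),z\big) \;=\; \sum_{\substack{\tau \in \mathrm{DC}(P)\\ \mathrm{des}_P(\tau)=k}} z^{\mathrm{Ldes}_P(\tau)} ,$$ where $\Delta'(P,k+1) = \{ f \in \mathcal{L}(P) : k < f(\hat 1) \le k+1 \}$ is the half-open $(P,k+1)$-hypersimplex.
   Context: For a poset $(P,\preceq)$, $a \lessdot b$ denotes a cover relation, and $\check{P} = P \cup \{\hat 0\}$ is $P$ with a new minimum $\hat 0$ adjoined (even if $P$ already has a minimum). The height $\mathrm{ht}(P)$ is the maximal number of elements in a chain of $P$. Lipschitz polytope: $\mathcal{L}(P) \subset \mathbb{R}^P$ is the set of all $f : P \to \mathbb{R}$ with $0 \le f(a) \le 1$ for every minimal element $a$ of $P$ and $0 \le f(b)-f(a) \le 1$ for every cover relation $a \lessdot b$ in $P$. $P$ is naturally labeled if its ground set is $\{1,\dots,n\}$, $n = |P|$, and $a \prec b$ implies $a < b$ as integers; one sets $\hat 0 := 0$. For $\tau \in \mathfrak{S}_n$ set $\tau(0) := 0$. For a saturated chain $C = \{\hat 0 = c_1 \lessdot \cdots \lessdot c_m = a\}$ in $\check{P}$ let $\mathrm{des}(\tau|_C)$ be the number of $1 \le j < m$ with $\tau(c_j) > \tau(c_{j+1})$. The permutation $\tau$ is descent-compatible with $P$ if for every $a \in P$ the number $\mathrm{des}(\tau|_C)$ is the same for all saturated chains $C$ in $\check{P}$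 from $\hat 0$ to $a$; then $\mathrm{des}_{P,\tau}(a)$ denotes this common number, and $\mathrm{des}_{P,\tau}(\hat 0) := 0$. $\mathrm{DC}(P) \subseteq \mathfrak{S}_n$ is the set of descent-compatible permutations, and for $\tau \in \mathrm{DC}(P)$ the number of $P$-descents is $\mathrm{des}_P(\tau) := \mathrm{des}_{P,\tau}(\hat 1)$. For $\tau \in \mathrm{DC}(P)$, $\mathrm{Ldes}_P(\tau)$ is the number of pairs $(a,b) \in \check{P} \times \check{P}$ with $\tau(a) = \tau(b) - 1$ such that either $\mathrm{des}_{P,\tau}(a) < \mathrm{des}_{P,\tau}(b)$, or $\mathrm{des}_{P,\tau}(a) = \mathrm{des}_{P,\tau}(b)$ and $a > b$ (as integers). For a half-open lattice polytope $S \subset \mathbb{R}^n$ (a full-dimensional lattice polytope with some of its facets removed, or the empty set), $E(S,m)$ denotes the polynomial in $m$ agreeing with $|mS \cap \mathbb{Z}^n|$ for all integers $m \ge 1$, and $h^*(S,z) = (1-z)^{n+1}\sum_{m \ge 0} E(S,m) z^m$ (so the $m=0$ term is the value of this polynomial at $0$). *)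

(* Defs.v *)
From HB Require Import structures.
From mathcomp Require Import all_boot all_order all_algebra perm.
From mathcomp Require Import boolp classical_sets functions cardinality reals.

Set Implicit Arguments.
Unset Strict Implicit.
Unset Printing Implicit Defensive.
Import Order.TTheory GRing.Theory Num.Theory.

Local Open Scope ring_scope.

Section FinitePosets.
Variables (T : finType) (le : rel T).

Definition slt : rel T := [rel a b | le a b && (a != b)].

Definition covers : rel T :=
  [rel a b | slt a b && ~~ [exists c, slt a c && slt c b]].

Definition minimal (a : T) : bool := ~~ [exists b, slt b a].

Definition maximal (a : T) : bool := ~~ [exists b, slt a b].

Definition is_chain (C : {set T}) : bool :=
  [forall a in C, forall b in C, le a b || le b a].

Definition height : nat := \max_(C : {set T} | is_chain C) #|C|.

End FinitePosets.

(* The ground set {1, ..., n} is encoded as 'I_n, with the label shifted by   *)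
(* one: i : 'I_n stands for the element i.+1.                                 *)
Definition naturally_labeled (n : nat) (le : rel 'I_n) : Prop :=
  [/\ reflexive le, antisymmetric le, transitive le
    & forall a b : 'I_n, slt le a b -> (a < b)%N].

Section Descents.
Variables (n : nat) (le : rel 'I_n).

(* P with a new minimum, on {0, ..., n}: ord0 is the new minimum and          *)
(* lift ord0 i, of value i.+1, is the copy of i : 'I_n.                       *)
Definition le_check : rel 'I_n.+1 := fun x y =>
  match unlift ord0 x, unlift ord0 y with
  | None, _ => true
  | Some _, None => false
  | Some a, Some b => le a b
  end.

(* The chain is ord0 :: s.                                                    *)
Definition saturated_chain (a : 'I_n.+1) (s : seq 'I_n.+1) : bool :=
  path (covers le_check) ord0 s && (last ord0 s == a).

(* lift_perm ord0 ord0 tau fixes ord0 and sends lift ord0 i to                *)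
(* lift ord0 (tau i).                                                         *)
Definition perm_check (tau : 'S_n) : 'S_n.+1 := lift_perm ord0 ord0 tau.

Definition chain_des (tau : 'S_n) (s : seq 'I_n.+1) : nat :=
  count (fun p => perm_check tau p.2 < perm_check tau p.1)%N
    (zip (ord0 :: s) s).

Definition descent_compatible (tau : 'S_n) : Prop :=
  forall (a : 'I_n) (s1 s2 : seq 'I_n.+1),
    saturated_chain (lift ord0 a) s1 -> saturated_chain (lift ord0 a) s2 ->
    chain_des tau s1 = chain_des tau s2.

Definition DC : {pred 'S_n} := fun tau => `[< descent_compatible tau >].

(* The common number of descents along the saturated chains ending at a,      *)
(* meaningful when tau \in DC; at ord0 the only chain is [::], with value 0.  *)
Definition des_at (tau : 'S_n) (a : 'I_n.+1) : nat :=
  xget 0%N (fun d => exists2 s, saturated_chain a s & d = chain_des tau s).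

Definition des_P (top : 'I_n) (tau : 'S_n) : nat :=
  des_at tau (lift ord0 top).

Definition Ldes (tau : 'S_n) : nat :=
  #|[pred p : 'I_n.+1 * 'I_n.+1 |
      ((perm_check tau p.1).+1 == perm_check tau p.2 :> nat)
      && ((des_at tau p.1 < des_at tau p.2)%N
          || ((des_at tau p.1 == des_at tau p.2) && (p.2 < p.1)%N))]|.

End Descents.

Section Polytopes.
Variable R : realType.
Local Open Scope classical_set_scope.

Definition lipschitz_polytope (n : nat) (le : rel 'I_n) :
    set {ffun 'I_n -> R} :=
  [set f | (forall a, minimal le a -> 0 <= f a <= 1)
        /\ (forall a b, covers le a b -> 0 <= f b - f a <= 1)].

Definition half_open_hypersimplex (n : nat) (le : rel 'I_n) (top : 'I_n)
    (k : nat) : set {ffun 'I_n -> R} :=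
  [set f | lipschitz_polytope le f /\ k%:R - 1 < f top <= k%:R].

Definition dilate_lattice_points (n : nat) (S : set {ffun 'I_n -> R})
    (m : nat) : set {ffun 'I_n -> R} :=
  [set [ffun i => m%:R * f i] | f in S] `&` [set f | forall i, f i \is a Num.int].

Definition is_ehrhart_poly (n : nat) (S : set {ffun 'I_n -> R})
    (E : {poly R}) : Prop :=
  forall m : nat, (0 < m)%N ->
    exists2 c : nat, (dilate_lattice_points S m #= `I_c)%card & E.[m%:R] = c%:R.

(* h is the h*-polynomial of S: the right-hand side is the coefficient of z^j *)
(* in (1 - z)^(n+1) \sum_m E(m) z^m.  The polynomial E is unique, being fixed *)
(* at all positive integers, and hence so is h.                               *)
Definition is_hstar (n : nat) (S : set {ffun 'I_n -> R}) (h : {poly R}) :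
    Prop :=
  exists2 E : {poly R}, is_ehrhart_poly S E &
    forall j : nat,
      h`_j = \sum_(i < j.+1) ((1 - 'X) ^+ n.+1)`_i * E.[(j - i)%:R].

End Polytopes.

Arguments half_open_hypersimplex R {n} le top k _.

(* Main.v *)
(* Write a lattice point N of the m-th dilate as N = m * q + r, where q is the *)
(* ceiling of N / m minus one (but q = 0 where N = 0), so that 0 <= r <= m and *)
(* r > 0 wherever q > 0.  List the elements by increasing r, ties being broken *)
(* by decreasing q and then by increasing label: this is a permutation tau.    *)
(* Along a cover q grows by 0 or 1, and by 1 exactly when tau descends, so tau *)
(* is descent-compatible and q is its descent function.  The values of r in    *)
(* the order of tau form a weakly increasing sequence in [0, m] starting at 0  *)
(* with strict steps exactly where Ldes counts, and every such sequence        *)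
(* arises; there are binomial(m + n - Ldes, n) of them, whose generating       *)
(* series is z ^ Ldes / (1 - z) ^ (n + 1).                                     *)

Require Import Defs.
From HB Require Import structures.
From mathcomp Require Import all_boot all_order all_algebra perm.
From mathcomp Require Import boolp classical_sets functions cardinality reals.
From mathcomp Require Import zify.

Set Implicit Arguments.
Unset Strict Implicit.
Unset Printing Implicit Defensive.
Import Order.TTheory GRing.Theory Num.Theory.

Local Open Scope ring_scope.

(** For m > 0, every lattice point of the m-th dilate is encoded by exactly one pair: a
    descent-compatible [tau] with k descents at the top, and a weakly increasing sequence [z] in
    [0, m]. The coordinate at x is m times the number of descents at x plus the entry of [z] at
    position [tau x]. Existence is [exists_alcove], uniqueness is [alcove_point_inj], and
    [dilate_hypersimplex] matches the condition on [des_P] with the slice k < f(top) <= k + 1.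

    Elements with equal remainder are listed by decreasing quotient, then by increasing label. A tie
    between consecutive elements is therefore forbidden exactly at the pairs counted by [Ldes]
    ([prec_step], [Ldes_steps]). By [card_staircase] each [tau] contributes C(m + n - Ldes, n)
    points. Since Ldes <= n, this is a polynomial in m whose values at all m >= 0 have generating
    series z^Ldes / (1 - z)^(n + 1) ([conv_binp]); summing over [tau] gives the theorem. *)

Section BinomialSeries.

(** * Binomial polynomials and their generating series *)

Variable R : realType.

(** The binomial coefficient C(X + n - L, n) as a polynomial in X. *)
Definition binp (n L : nat) : {poly R} :=
  (n`!%:R)^-1 *: \prod_(i < n) ('X + ((n%:R - L%:R) - i%:R)%:P).

Lemma natr_ffact (N n : nat) :
  (N ^_ n)%:R = \prod_(i < n) (N%:R - i%:R) :> R.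
Proof.
elim: n => [|n IHn]; first by rewrite ffactn0 big_ord0.
rewrite ffactnSr natrM IHn big_ord_recr /=.
case: (leqP n N) => [leNn|ltNn]; first by rewrite natrB.
by rewrite -IHn ffact_small // !mul0r.
Qed.

Lemma horner_binp (n L m : nat) :
  (L <= n)%N -> (binp n L).[m%:R] = 'C(m + n - L, n)%:R.
Proof.
move=> leLn; rewrite /binp hornerZ horner_prod.
under eq_bigr => i _ do
  rewrite hornerD hornerX hornerC !addrA -natrD -natrB ?(leq_trans leLn) ?leq_addl //.
rewrite -natr_ffact -bin_ffact natrM mulrC mulfK //.
by rewrite pnatr_eq0 -lt0n fact_gt0.
Qed.

Definition bwdiff (b : nat -> R) (t : nat) : R :=
  b t - (if t is t'.+1 then b t' else 0).

(** Multiplying a power series by 1 - z takes backward differences of its coefficients. Only the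
    terms up to degree j matter, so the series is truncated to a polynomial and associativity of the
    product is used. *)
Lemma conv_mul1BX (p : {poly R}) (b : nat -> R) (j : nat) :
  \sum_(i < j.+1) (p * (1 - 'X))`_i * b (j - i)%N =
  \sum_(i < j.+1) p`_i * bwdiff b (j - i)%N.
Proof.
pose B := \poly_(t < j.+1) b t.
have -> : \sum_(i < j.+1) (p * (1 - 'X))`_i * b (j - i)%N
    = (p * (1 - 'X) * B)`_j.
  by rewrite coefM; apply: eq_bigr => i _; rewrite coef_poly ltnS leq_subr.
rewrite -mulrA coefM; apply: eq_bigr => i _; congr (_ * _).
rewrite mulrBl mul1r coefB coefXM !coef_poly ltnS leq_subr /bwdiff.
case: (j - i)%N (leq_subr i j) => [|t] //= ltj.
by rewrite ltnS (ltnW ltj).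
Qed.

(** This is the expansion of z^L / (1 - z)^(n + 1), by induction on n: each factor 1 - z lowers n by
    one through Pascal's rule. The induction takes n below L, where truncated subtraction and C(_,
    0) = 1 would give wrong terms; hence the guard. *)
Lemma conv_binomial (n L j : nat) :
  \sum_(i < j.+1) ((1 - 'X) ^+ n.+1 : {poly R})`_i *
    (if (L <= j - i)%N then 'C(j - i + n - L, n)%:R else 0) = (j == L)%:R.
Proof.
elim: n => [|n IHn].
  rewrite -{1}[_ ^+ 1]mul1r expr1.
  rewrite (conv_mul1BX 1 (fun t => if (L <= t)%N then 'C(t + 0 - L, 0)%:R else 0)).
  rewrite big_ord_recl big1 => [|i _]; last by rewrite coef1 mul0r.
  rewrite coef1 mul1r addr0 subn0 /bwdiff /= bin0.
  case: j => [|j]; first by rewrite leqn0 eq_sym subr0; case: eqP.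
  rewrite bin0 leq_eqVlt ltnS [L == _]eq_sym; case: eqP => [<-|_] /=.
    by rewrite ltnn subr0.
  by case: (L <= j)%N; rewrite subrr.
rewrite exprSr.
rewrite (conv_mul1BX _ (fun t => if (L <= t)%N then 'C(t + n.+1 - L, n.+1)%:R else 0)).
rewrite -IHn; apply: eq_bigr => i _; congr (_ * _); rewrite /bwdiff.
case: (j - i)%N => [|t].
  case: leqP => // leL0; last by rewrite subrr.
  by rewrite subr0 (_ : L = 0%N) ?subn0 ?add0n ?binn //; lia.
(* At t + 1 = L the preceding term is guarded to 0 and both sides are 1; above L this is Pascal's
   rule. *)
case: (ltngtP L t.+1) => [leLt|gtL|->]; last first.
- rewrite ltnn subr0 (_ : (t.+1 + n.+1 - t.+1)%N = n.+1) 1?(_ : (t.+1 + n - t.+1)%N = n) ?binn //; lia.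
- by case: leqP; [lia | rewrite subrr].
rewrite ltnS in leLt; rewrite leLt.
rewrite (_ : (t.+1 + n.+1 - L)%N = (t + n.+1 - L).+1); last by lia.
rewrite (_ : (t.+1 + n - L)%N = (t + n.+1 - L)%N); last by lia.
by rewrite binS natrD addrAC subrr add0r.
Qed.

Lemma conv_binp (n L j : nat) : (L <= n)%N ->
  \sum_(i < j.+1) ((1 - 'X) ^+ n.+1 : {poly R})`_i * (binp n L).[(j - i)%:R]
    = (j == L)%:R.
Proof.
move=> leLn; rewrite -(conv_binomial n); apply: eq_bigr => i _; congr (_ * _).
rewrite horner_binp //; case: leqP => // ltL.
by rewrite bin_small //; lia.
Qed.

End BinomialSeries.

(** * Counting weakly increasing sequences with prescribed strict steps *)

Section Staircases.
Local Open Scope nat_scope.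

Definition ext0 (n : nat) (V : Type) (v0 : V) (f : 'I_n -> V) (x : 'I_n.+1) : V :=
  if unlift ord0 x is Some a then f a else v0.

Lemma ext0_0 (n : nat) (V : Type) (v0 : V) (f : 'I_n -> V) :
  ext0 v0 f ord0 = v0.
Proof. by rewrite /ext0 unlift_none. Qed.

Lemma ext0_lift (n : nat) (V : Type) (v0 : V) (f : 'I_n -> V) (a : 'I_n) :
  ext0 v0 f (lift ord0 a) = f a.
Proof. by rewrite /ext0 liftK. Qed.

Variables (n m : nat).

(** The n free entries occupy positions 1 to n; position 0, that of the added minimum, holds the
    value 0. *)
Definition stair (z : {ffun 'I_n -> 'I_m.+1}) (j : nat) : nat :=
  ext0 0 (fun i => z i : nat) (inord j).

Lemma stair0 z : stair z 0 = 0.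
Proof. by rewrite /stair (_ : inord 0 = ord0) ?ext0_0 //; apply/val_inj; rewrite /= inordK. Qed.

Lemma stairS z (j : 'I_n) : stair z j.+1 = z j.
Proof.
rewrite /stair (_ : inord j.+1 = lift ord0 j) ?ext0_lift //.
by apply/val_inj; rewrite /= inordK // ltnS.
Qed.

Definition staircase (e : nat -> bool) (z : {ffun 'I_n -> 'I_m.+1}) : bool :=
  [forall j : 'I_n, stair z j + e j <= stair z j.+1].

Lemma staircase_mono e z (i j : nat) : staircase e z -> i <= j <= n ->
  stair z i + \sum_(i <= l < j) e l <= stair z j.
Proof.
move=> /forallP ez /andP[leij lejn].
elim: j leij lejn => [|j IHj]; first by rewrite leqn0 => /eqP->; rewrite big_geq ?addn0.
rewrite leq_eqVlt => /predU1P[-> _|]; first by rewrite big_geq ?addn0.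
rewrite ltnS => leij ltjn; rewrite big_nat_recr //= addnA.
apply: leq_trans (ez (Ordinal ltjn)) => /=.
by rewrite leq_add2r IHj // ltnW.
Qed.

Lemma card_staircase (e : nat -> bool) :
  #|[set z | staircase e z]| = 'C(m + n - \sum_(0 <= i < n) e i, n).
Proof.
set L := \sum_(0 <= i < n) e i; rewrite -card_ltn_sorted_tuples.
pose S j := \sum_(0 <= i < j) e i.
have leS j : S j <= j.
  elim: j => [|j IHj]; first by rewrite /S big_geq.
  by rewrite /S big_nat_recr //=; move: IHj; rewrite /S; case: (e j); lia.
have splitS i j : i <= j -> S j = S i + \sum_(i <= l < j) e l.
  by move=> leij; rewrite /S -big_cat_nat.
have SS j : S j.+1 = S j + e j by rewrite /S big_nat_recr.
have leL j : j <= n -> S j <= L by move=> lej; rewrite [L](splitS j) // leq_addr.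
have leSL j : j <= n -> L <= S j + (n - j).
  move=> lej; rewrite [L](splitS j) // leq_add2l.
  rewrite -[leqRHS]muln1 -sum_nat_const_nat; apply: leq_sum => l _.
  by case: (e l).
(* The bound is made opaque, as it occurs in the types of the tuples. *)
have [N NE] : {N | N = m + n - L} by exists (m + n - L).
rewrite -NE.
pose T (t : n.-tuple 'I_N) (j : 'I_n) : nat := tnth t j.
(* Remove j, and put back the [S j.+1] strict steps required up to position j + 1. The bounds [lowB]
   and [highB] keep the result in [0, m], so [inord] is harmless. *)
pose G (t : n.-tuple 'I_N) : {ffun 'I_n -> 'I_m.+1} :=
  [ffun j : 'I_n => inord (T t j - j + S j.+1)].
pose B := [set t : n.-tuple 'I_N | sorted ltn [seq \val i | i <- t]].
have sortB (t : n.-tuple 'I_N) : reflect (forall i j : 'I_n, i < j -> T t i < T t j) (t \in B).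
  have nthE (i : 'I_n) : nth 0 [seq \val i | i <- t] i = T t i.
    by rewrite (nth_map (tnth t i)) ?size_tuple // -tnth_nth.
  rewrite inE; apply: (iffP idP) => [sor i j ltij | mono].
    have:= sorted_ltn_nth ltn_trans 0 sor; move/(_ i j).
    by rewrite !inE size_map size_tuple !ltn_ord !nthE; apply.
  apply: pairwise_sorted; apply/(pairwiseP 0) => i j.
  rewrite !inE size_map size_tuple => lti ltj ltij.
  have := mono (Ordinal lti) (Ordinal ltj) ltij.
  by rewrite -!nthE.
have lowB t (j : 'I_n) : t \in B -> j <= T t j.
  move/sortB=> mono; case: j; elim=> [//|j IHj] ltj.
  apply: leq_ltn_trans (IHj (ltnW ltj)) _; exact: mono.
have highB t (j : 'I_n) : t \in B -> T t j + (n - j) <= N.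
  move/sortB=> mono.
  have : forall l (ltl : j + l < n), T t j + l <= T t (Ordinal ltl).
    elim=> [|l IHl] ltl.
      by rewrite addn0 (_ : Ordinal ltl = j) //; apply/val_inj; rewrite /= addn0.
    have ltl' : j + l < n by lia.
    rewrite addnS; apply: leq_ltn_trans (IHl ltl') _; apply: mono => /=; lia.
  have ltl : j + (n - j.+1) < n by have := ltn_ord j; lia.
  have ltT (i : 'I_n) : T t i < N by exact: ltn_ord.
  move/(_ _ ltl); have := ltT (Ordinal ltl); have := ltn_ord j; lia.
have GE t (j : 'I_n) : t \in B -> G t j = T t j - j + S j.+1 :> nat.
  move=> tB; rewrite ffunE inordK //.
  have := lowB t j tB; have := highB t j tB; have := leL _ (ltn_ord j).
  have := leSL _ (ltn_ord j); have := ltn_ord j.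
  move: (T t j) (S j.+1) => a b; rewrite NE; lia.
have Ginj : {in B &, injective G}.
  move=> t1 t2 t1B t2B eqG; apply: eq_from_tnth => j; apply: ord_inj.
  rewrite -![nat_of_ord (tnth _ _)]/(T _ _).
  have := GE t1 j t1B; have := GE t2 j t2B; rewrite eqG => ->.
  have := lowB t1 j t1B; have := lowB t2 j t2B; lia.
rewrite -(card_in_imset Ginj); congr #|pred_of_set _|; apply/setP => z.
rewrite inE; apply/idP/imsetP => [ez | [t tB ->]]; last first.
  apply/forallP => j; rewrite stairS GE //.
  case: j => -[|j] ltj /=; first by rewrite stair0 SS; lia.
  have ltj' : j < n by apply: ltnW.
  rewrite (stairS _ (Ordinal ltj')) GE //= SS [S j.+2]SS.
  have /sortB/(_ (Ordinal ltj') (Ordinal ltj) (ltnSn _)) := tB.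
  have := lowB t (Ordinal ltj') tB; rewrite SS /=; lia.
have lowz (j : 'I_n) : S j.+1 <= z j.
  have := @staircase_mono e z 0 j.+1 ez (ltn_ord j).
  by rewrite stair0 stairS.
have bw (j : 'I_n) : z j + j - S j.+1 < N.
  have := lowz j; have := leSL _ (ltn_ord j); have := ltn_ord (z j).
  have := leL _ (ltn_ord j); have := ltn_ord j.
  by move: (nat_of_ord (z j)) (S j.+1) => a b; rewrite NE; lia.
pose t := [tuple Ordinal (bw j) | j < n].
have tB : t \in B.
  apply/sortB => i j ltij; rewrite /T !tnth_mktuple /=.
  have ltij1 : i.+1 <= j.+1 <= n by rewrite ltnS (ltnW ltij) ltn_ord.
  have := staircase_mono ez ltij1; have /andP[/splitS eqS _] := ltij1.
  move: eqS (lowz i) (lowz j); rewrite !stairS.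
  move: (S i.+1) (S j.+1) (nat_of_ord (z i)) (nat_of_ord (z j)) (\sum_(_ <= _ < _) _).
  move=> a b c d f; lia.
exists t => //; apply/ffunP => j; apply/val_inj; rewrite /= GE //.
rewrite /T tnth_mktuple /=; have := lowz j.
by move: (nat_of_ord (z j)) (S j.+1) => a b; lia.
Qed.

End Staircases.

(** * Descent-compatibility as the existence of a potential *)

Section DescentPotential.
Local Open Scope nat_scope.
Variables (n : nat) (le : rel 'I_n).
Hypothesis lab : naturally_labeled le.

Lemma perm_check0 (tau : 'S_n) : perm_check tau ord0 = ord0.
Proof. by rewrite /perm_check lift_perm_id. Qed.

Lemma perm_check_lift (tau : 'S_n) (a : 'I_n) :
  perm_check tau (lift ord0 a) = lift ord0 (tau a).
Proof. by rewrite /perm_check lift_perm_lift. Qed.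

Lemma slt_check_lift (a b : 'I_n) :
  slt (le_check le) (lift ord0 a) (lift ord0 b) = slt le a b.
Proof. by rewrite /slt /= /le_check !liftK (inj_eq lift_inj). Qed.

Lemma slt_check0 (b : 'I_n) : slt (le_check le) ord0 (lift ord0 b).
Proof. by rewrite /slt /= /le_check unlift_none. Qed.

Lemma slt_checkr0 (x : 'I_n.+1) : slt (le_check le) x ord0 = false.
Proof.
by rewrite /slt /= /le_check unlift_none; case: unliftP => [a ->|->]; rewrite ?eqxx ?andbF.
Qed.

Lemma slt_check_lt (x y : 'I_n.+1) : slt (le_check le) x y -> x < y.
Proof.
case: (unliftP ord0 y) => [b ->|->]; last by rewrite slt_checkr0.
case: (unliftP ord0 x) => [a ->|->]; last by rewrite lift0.
by rewrite slt_check_lift !lift0 ltnS; case: lab => _ _ _; apply.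
Qed.

Lemma covers_check_lift (a b : 'I_n) :
  covers (le_check le) (lift ord0 a) (lift ord0 b) = covers le a b.
Proof.
rewrite /covers /= slt_check_lift; congr (_ && ~~ _).
apply/existsP/existsP => [[x]|[c]].
  case: (unliftP ord0 x) => [c ->|->]; last by rewrite slt_checkr0.
  by rewrite !slt_check_lift; exists c.
by exists (lift ord0 c); rewrite !slt_check_lift.
Qed.

Lemma covers_check0 (b : 'I_n) :
  covers (le_check le) ord0 (lift ord0 b) = minimal le b.
Proof.
rewrite /covers /= slt_check0; congr (~~ _).
apply/existsP/existsP => [[x]|[c ltcb]].
  case: (unliftP ord0 x) => [c ->|->]; last by rewrite slt_checkr0.
  by rewrite slt_check_lift => /andP[_]; exists c.
by exists (lift ord0 c); rewrite slt_check0 slt_check_lift.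
Qed.

Lemma covers_checkr0 (x : 'I_n.+1) : covers (le_check le) x ord0 = false.
Proof. by rewrite /covers /= slt_checkr0. Qed.

Lemma covers_check_lt (x y : 'I_n.+1) : covers (le_check le) x y -> x < y.
Proof. by case/andP=> /slt_check_lt. Qed.

(** Among the elements strictly below b, the one with the largest label is covered by b: anything in
    between would have a larger label. *)
Lemma exists_covers_check (b : 'I_n) :
  exists x, covers (le_check le) x (lift ord0 b).
Proof.
pose below x := slt (le_check le) x (lift ord0 b).
case: (@arg_maxnP _ ord0 below (@nat_of_ord _) (slt_check0 b)) => x ltxb maxx.
exists x; rewrite /covers /= -/(below x) ltxb; apply/existsP => -[c /andP[ltxc ltcb]].
by have := maxx c ltcb; rewrite /= leqNgt slt_check_lt.
Qed.

Lemma exists_saturated_chain (x : 'I_n.+1) : exists s, saturated_chain le x s.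
Proof.
have [k] := ubnP (x : nat); elim: k x => // k IHk x; rewrite ltnS => lexk.
case: (unliftP ord0 x) lexk => [b|] -> lexk; last first.
  by exists [::]; rewrite /saturated_chain /= eqxx.
have [y cyb] := exists_covers_check b.
have [|s /andP[ps /eqP ls]] := IHk y.
  exact: leq_trans (covers_check_lt cyb) lexk.
exists (rcons s (lift ord0 b)).
by rewrite /saturated_chain rcons_path ps ls cyb last_rcons eqxx.
Qed.

(** A local form of descent-compatibility: one equation per cover relation in place of a comparison
    of whole chains. *)
Definition is_potential (tau : 'S_n) (q : 'I_n.+1 -> nat) : Prop :=
  q ord0 = 0 /\ forall x y, covers (le_check le) x y ->
    q y = q x + (perm_check tau y < perm_check tau x).

Lemma chain_des_potential (tau : 'S_n) (q : 'I_n.+1 -> nat) x s :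
  is_potential tau q -> saturated_chain le x s -> chain_des tau s = q x.
Proof.
case=> q0 qS /andP[ps /eqP <-]; rewrite /chain_des.
rewrite -[RHS]subn0 -q0; elim: s ord0 ps => [|y s IHs] z /=.
  by rewrite subnn.
case/andP=> czy ps; rewrite IHs // (qS _ _ czy).
(* The telescoping uses truncated subtraction, so the potential must be known to grow along the
   chain. *)
suff : q y <= q (last y s) by rewrite (qS _ _ czy); lia.
elim: s y ps {IHs czy} => //= v s IHs y /andP[cyv /IHs].
by apply: leq_trans; rewrite (qS _ _ cyv) leq_addr.
Qed.

(** The descents along a chain telescope to the value of the potential at its end, whatever the
    chain. Every element is the end of some chain, so [des_at] is not a default value. *)
Lemma DC_potential (tau : 'S_n) (q : 'I_n.+1 -> nat) :
  is_potential tau q -> tau \in DC le /\ des_at le tau =1 q.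
Proof.
move=> qP; split.
  rewrite unfold_in; apply/asboolP => a s1 s2 ch1 ch2.
  by rewrite (chain_des_potential qP ch1) (chain_des_potential qP ch2).
move=> x; have [s chs] := exists_saturated_chain x.
apply: xget_unique; first by exists s => //; rewrite (chain_des_potential qP chs).
by move=> d [s' chs' ->]; rewrite (chain_des_potential qP chs').
Qed.

Lemma saturated_chain0 s : saturated_chain le ord0 s -> s = [::].
Proof.
case/lastP: s => // s x /andP[]; rewrite rcons_path last_rcons => /andP[_ cx] /eqP x0.
by rewrite x0 covers_checkr0 in cx.
Qed.

Lemma des_atE (tau : 'S_n) x s : tau \in DC le ->
  saturated_chain le x s -> des_at le tau x = chain_des tau s.
Proof.
rewrite unfold_in => /asboolP dc chs; apply: xget_unique; first by exists s.
move=> d [s' chs' ->]; case: (unliftP ord0 x) chs chs' => [a|] ->.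
  by move=> chs chs'; apply: dc chs' chs.
by move=> /saturated_chain0-> /saturated_chain0->.
Qed.

(** Extending a saturated chain to x by a cover of x adds a single comparison to its descent
    count. *)
Lemma des_at_potential (tau : 'S_n) :
  tau \in DC le -> is_potential tau (des_at le tau).
Proof.
move=> dc; split.
  by rewrite (@des_atE _ _ [::]) // /saturated_chain /= eqxx.
move=> x y cxy; have [s chs] := exists_saturated_chain x.
have /andP[ps /eqP ls] := chs.
rewrite (des_atE dc chs) (@des_atE _ _ (rcons s y)) //; last first.
  by rewrite /saturated_chain rcons_path ps ls cxy last_rcons eqxx.
rewrite /chain_des -[x]ls; elim: s ord0 {chs ps ls} => [|z s IHs] w /=.
  by rewrite addn0.
by rewrite IHs addnA.
Qed.

End DescentPotential.

(** * Sorting permutations, tie-breaking and [Ldes] *)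

Section Sorting.
Local Open Scope nat_scope.
Variable n : nat.
Implicit Types (y d : 'I_n.+1 -> nat) (a b c : 'I_n.+1) (tau : 'S_n).

Definition prec y d a b : bool :=
  (y a < y b) || ((y a == y b) && ((d b < d a) || ((d a == d b) && (a < b)))).

Lemma prec_trans y d : transitive (prec y d).
Proof. by move=> b a c; rewrite /prec; lia. Qed.

Lemma prec_irr y d a : prec y d a a = false.
Proof. by rewrite /prec !ltnn !andbF. Qed.

Lemma prec_total y d a b : a != b -> prec y d a b || prec y d b a.
Proof. by rewrite -val_eqE /= /prec; lia. Qed.

Definition sorts tau y d : Prop :=
  forall a b, perm_check tau a < perm_check tau b -> prec y d a b.

Definition at_pos tau (j : nat) : 'I_n.+1 := (perm_check tau)^-1%g (inord j).

Lemma perm_check_at_pos tau j : j <= n -> perm_check tau (at_pos tau j) = j :> nat.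
Proof. by move=> lejn; rewrite permKV inordK. Qed.

Lemma at_posK tau a : at_pos tau (perm_check tau a) = a.
Proof. by rewrite /at_pos inord_val permK. Qed.

(** Walking through the list of [tau], each element comes strictly after the previous one in the
    list of [tau'] too, so its position there is at least as large. By symmetry the two permutations
    agree. *)
Lemma sorts_le tau tau' y d a :
  sorts tau y d -> sorts tau' y d -> perm_check tau a <= perm_check tau' a.
Proof.
move=> sor sor'; rewrite -{2}(at_posK tau a).
have : perm_check tau a <= n by rewrite -ltnS ltn_ord.
elim: (perm_check tau a : nat) => // j IHj ltjn.
apply: leq_ltn_trans (IHj (ltnW ltjn)) _.
have pj : prec y d (at_pos tau j) (at_pos tau j.+1).
  by apply: sor; rewrite !perm_check_at_pos // ltnW.
rewrite ltnNge leq_eqVlt; apply/norP; split.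
  apply/eqP => /val_inj/perm_inj eqj.
  by rewrite eqj prec_irr in pj.
by apply/negP => /sor' /(prec_trans pj); rewrite prec_irr.
Qed.

Lemma sorts_inj tau tau' y d : sorts tau y d -> sorts tau' y d -> tau = tau'.
Proof.
move=> sor sor'; apply/permP => i; apply: (@lift_inj _ ord0).
rewrite -!perm_check_lift; apply/val_inj/eqP => /=.
by rewrite eqn_leq (sorts_le _ sor sor') (sorts_le _ sor' sor).
Qed.

(** The permutation sends an element to the number of elements of P that precede it; totality makes
    this injective. The hypothesis is needed because [perm_check] fixes [ord0]. *)
Lemma exists_sorts y d : (forall i : 'I_n, prec y d ord0 (lift ord0 i)) ->
  exists tau, sorts tau y d.
Proof.
move=> min0.
pose below (i : 'I_n) := [set j : 'I_n | prec y d (lift ord0 j) (lift ord0 i)].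
have ltbelow i : #|below i| < n.
  rewrite -[n in _ < n]card_ord -cardsT; apply: proper_card.
  by apply/properP; split; [exact: finset.subsetT | exists i; rewrite !inE ?prec_irr].
pose rank i := Ordinal (ltbelow i).
have mono i j : prec y d (lift ord0 i) (lift ord0 j) -> rank i < rank j.
  move=> pij; apply: proper_card; apply/properP; split.
    by apply/fintype.subsetP => l; rewrite !inE => pli; apply: prec_trans pli pij.
  by exists i; rewrite !inE ?prec_irr.
have rank_inj : injective rank.
  move=> i j eqr; apply/eqP; apply: contraT => neij.
  have : lift ord0 i != lift ord0 j by rewrite (inj_eq lift_inj).
  by move/(prec_total y d)/orP => [] /mono; rewrite eqr ltnn.
exists (perm rank_inj) => a b.
case: (unliftP ord0 b) => [j ->|->]; last by rewrite perm_check0 ltn0.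
case: (unliftP ord0 a) => [i ->|-> _]; last exact: min0.
rewrite !perm_check_lift !lift0 ltnS !permE => ltij.
have neij : lift ord0 i != lift ord0 j.
  by rewrite (inj_eq lift_inj); apply: contraTneq ltij => ->; rewrite ltnn.
have /orP[//|/mono ltji] := prec_total y d neij.
by have := ltn_trans ltij ltji; rewrite ltnn.
Qed.

Definition strict d a b : bool := (d a < d b) || ((d a == d b) && (b < a)).

Definition steps tau d (j : nat) : bool :=
  strict d (at_pos tau j) (at_pos tau j.+1).

(** For distinct elements, [strict d a b] says that the tie-breaking rule puts b before a; then a
    can precede b only if y increases strictly. It is also the condition in [Ldes]. *)
Lemma prec_step y d a b : a != b -> prec y d a b = (y a + strict d a b <= y b).
Proof. by rewrite -val_eqE /= /prec /strict; lia. Qed.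

Lemma staircaseP m tau d (z : {ffun 'I_n -> 'I_m.+1}) :
  reflect (sorts tau (fun a => stair z (perm_check tau a)) d)
          (staircase (steps tau d) z).
Proof.
set y := fun a => _.
have stepE j : j < n -> (stair z j + steps tau d j <= stair z j.+1)
    = prec y d (at_pos tau j) (at_pos tau j.+1).
  move=> ltjn; rewrite prec_step /y ?perm_check_at_pos ?(ltnW ltjn) //.
  rewrite -(inj_eq (@perm_inj _ (perm_check tau))) -val_eqE /=.
  by rewrite !perm_check_at_pos ?(ltnW ltjn) // neq_ltn ltnSn.
apply: (iffP forallP) => [ez a b ltab | sor j]; last first.
  rewrite stepE //; apply: sor; rewrite !perm_check_at_pos ?ltnSn //.
  exact: ltnW.
rewrite -(at_posK tau a) -(at_posK tau b).
have bnd c : perm_check tau c <= n by rewrite -ltnS ltn_ord.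
(* The staircase condition orders neighbouring positions; transitivity of [prec] extends this to all
   pairs. *)
apply: (@homo_ltn_in _ (fun j => j <= n) (at_pos tau) (fun a b => prec y d a b)) => //.
- by move=> v u w; apply: prec_trans.
- by move=> i j; rewrite !unfold_in => _ lej l /andP[_ /ltnW/leq_trans]; apply.
- by move=> j _; rewrite unfold_in => ltjn; rewrite -stepE // (ez (Ordinal ltjn)).
- exact: bnd.
- exact: bnd.
Qed.

Lemma Ldes_steps (le : rel 'I_n) tau :
  Ldes le tau = \sum_(0 <= j < n) steps tau (des_at le tau) j.
Proof.
pose f (j : 'I_n) := (at_pos tau j, at_pos tau j.+1).
have f_inj : injective f.
  move=> i j [/(congr1 (perm_check tau))/(congr1 val) /= + _].
  by rewrite !perm_check_at_pos ?(ltnW (ltn_ord _)) // => /val_inj.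
rewrite big_mkord -(big_mkcond (fun j : 'I_n => steps tau (des_at le tau) j) (fun=> 1)).
rewrite sum1dep_card -(card_imset _ f_inj) /Ldes.
apply: eq_card => -[a b]; rewrite !inE /=; apply/andP/imsetP => [[/eqP eqab st]|].
  have ltan : perm_check tau a < n by rewrite -ltnS eqab ltn_ord.
  exists (Ordinal ltan); rewrite ?inE /steps /f /= eqab !at_posK //.
case=> j; rewrite inE => st [-> ->]; split=> //.
by rewrite !perm_check_at_pos // ltnW.
Qed.

Lemma Ldes_le (le : rel 'I_n) tau : Ldes le tau <= n.
Proof.
rewrite Ldes_steps -[leqRHS]subn0 -[leqRHS]muln1 -sum_nat_const_nat.
by apply: leq_sum => j _; case: steps.
Qed.

End Sorting.

(** * Encoding integral Lipschitz functions by a permutation and a staircase *)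

Section LatticePoints.
Local Open Scope nat_scope.
Variables (n : nat) (le : rel 'I_n) (m : nat).
Hypotheses (lab : naturally_labeled le) (m_gt0 : 0 < m).

Definition lipschitz_nat (N : 'I_n.+1 -> nat) : Prop :=
  forall x y, covers (le_check le) x y -> N x <= N y <= N x + m.

(** The lattice points of the m-th dilate of a half-open simplex, in coordinates sorted by [tau]. *)
Definition alcove (tau : 'S_n) : pred {ffun 'I_n -> 'I_m.+1} :=
  [pred z | staircase (steps tau (des_at le tau)) z].

Definition alcove_point (tau : 'S_n) (z : {ffun 'I_n -> 'I_m.+1}) x : nat :=
  m * des_at le tau x + stair z (perm_check tau x).

Lemma stair_le (z : {ffun 'I_n -> 'I_m.+1}) j : stair z j <= m.
Proof.
by rewrite /stair /ext0; case: unlift => // i; rewrite -ltnS ltn_ord.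
Qed.

(** A remainder 0 would tie with the added minimum, and the element with the larger quotient would
    then have to come before that minimum. Positivity is what makes the quotient recoverable in
    [alcove_point_div]. *)
Lemma stair_gt0 tau (z : {ffun 'I_n -> 'I_m.+1}) x : tau \in DC le ->
  z \in alcove tau -> 0 < des_at le tau x -> 0 < stair z (perm_check tau x).
Proof.
move=> dc /staircaseP sor dx.
have [d0 _] := des_at_potential lab dc.
case: (unliftP ord0 x) dx => [a|] ->; last by rewrite d0.
have /sor : perm_check tau ord0 < perm_check tau (lift ord0 a).
  by rewrite perm_check0 perm_check_lift lift0.
by rewrite /prec perm_check0 stair0 d0; lia.
Qed.

Lemma alcove_point0 tau z : tau \in DC le -> alcove_point tau z ord0 = 0.
Proof.
move=> dc; have [d0 _] := des_at_potential lab dc.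
by rewrite /alcove_point d0 perm_check0 stair0 muln0.
Qed.

Lemma alcove_point_div tau z x : tau \in DC le -> z \in alcove tau ->
  (alcove_point tau z x).-1 %/ m = des_at le tau x.
Proof.
move=> dc zP; have := stair_gt0 dc zP (x := x); rewrite /alcove_point.
have := stair_le z (perm_check tau x).
case: (des_at le tau x) => [|d] yle ygt.
  by rewrite muln0 add0n divn_small //; lia.
have /ygt y0 := ltn0Sn d.
rewrite -(prednK y0) addnS /= mulnC divnMDl // divn_small ?addn0 //; lia.
Qed.

(** Along a cover where [tau] ascends, the quotient stays and the remainder grows by at most m;
    where [tau] descends, the quotient gains 1 and the remainder drops by at most m. *)
Lemma alcove_point_lipschitz tau z : tau \in DC le -> z \in alcove tau ->
  lipschitz_nat (alcove_point tau z).
Proof.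
move=> dc /staircaseP sor x y cxy; have [_ dS] := des_at_potential lab dc.
rewrite /alcove_point (dS _ _ cxy) mulnDr.
have := stair_le z (perm_check tau x); have := stair_le z (perm_check tau y).
have neq : perm_check tau x != perm_check tau y.
  rewrite (inj_eq perm_inj); apply: contraTneq cxy => ->.
  by rewrite /covers /= /slt /= eqxx andbF.
move: neq; rewrite -val_eqE neq_ltn => /orP[] lt; have := sor _ _ lt.
  by rewrite (ltnNge (perm_check tau y)) (ltnW lt) muln0 /prec; lia.
by rewrite lt muln1 /prec; lia.
Qed.

(** The point determines the quotients, hence the remainders; these two functions determine the
    sorting permutation, and then the sequence. *)
Lemma alcove_point_inj tau tau' z z' :
  tau \in DC le -> tau' \in DC le -> z \in alcove tau -> z' \in alcove tau' ->
  alcove_point tau z =1 alcove_point tau' z' -> tau = tau' /\ z = z'.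
Proof.
move=> dc dc' zP zP' eqN.
have eqd : des_at le tau = des_at le tau'.
  by apply/funext => x; rewrite -(alcove_point_div x dc zP) eqN alcove_point_div.
have eqy : (fun x => stair z (perm_check tau x))
    = (fun x => stair z' (perm_check tau' x)).
  apply/funext => x; have := eqN x; rewrite /alcove_point eqd.
  exact: addnI.
have eqtau : tau = tau'.
  move: zP zP' => /staircaseP sor /staircaseP sor'.
  by rewrite eqd eqy in sor; apply: sorts_inj sor sor'.
split=> //; apply/ffunP => j; apply/val_inj => /=.
move/(congr1 (fun g => g (at_pos tau j.+1))): eqy.
by rewrite -eqtau perm_check_at_pos // !stairS.
Qed.

Lemma exists_alcove (N : 'I_n.+1 -> nat) : N ord0 = 0 -> lipschitz_nat N ->
  exists tau z, [/\ tau \in DC le, z \in alcove tau & alcove_point tau z =1 N].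
Proof.
move=> N0 lipN.
pose q x := (N x).-1 %/ m; pose r x := N x - m * q x.
have NE x : N x = m * q x + r x.
  by rewrite subnKC // mulnC (leq_trans (leq_divM _ _)) ?leq_pred.
have rle x : r x <= m.
  have := divn_eq (N x).-1 m; have := ltn_pmod (N x).-1 m_gt0.
  by rewrite /r mulnC -/(q x); move: (_ * _) => a; lia.
have rgt x : 0 < N x -> 0 < r x.
  have := divn_eq (N x).-1 m; rewrite /r mulnC -/(q x).
  by move: (_ * _) => a; lia.
have q0 x : N x = 0 -> q x = 0 by rewrite /q => ->; rewrite div0n.
have r0 x : N x = 0 -> r x = 0 by rewrite /r => ->.
have [i|tau sor] := @exists_sorts n r q.
  rewrite /prec (r0 ord0) // (q0 ord0) //.
  case: (posnP (N (lift ord0 i))) => [Ni|/rgt-> //].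
  by rewrite (r0 _ Ni) (q0 _ Ni) lift0.
(* If q is constant along the cover, the remainder does not drop, and on a tie the smaller label x
   comes first. If q gains 1, the remainder does not grow, and on a tie the larger quotient y comes
   first. *)
have qP : is_potential le tau q.
  split=> [|x y cxy]; first exact: q0.
  have /andP[leN leNm] := lipN _ _ cxy.
  have qle : q x <= q y by rewrite leq_div2r //; lia.
  have qleS : q y <= q x + 1.
    rewrite addnC -(divnMDl 1 _ m_gt0) mul1n; apply: leq_div2r.
    by move: leN leNm; lia.
  have := NE x; have := NE y.
  have ltxy := covers_check_lt lab cxy.
  have neq : perm_check tau x != perm_check tau y.
    rewrite (inj_eq perm_inj) -val_eqE /= neq_ltn ltxy //.
  have qy : q y = q x \/ q y = q x + 1 by lia.
  move: neq; rewrite -val_eqE neq_ltn => /orP[] lt; have := sor _ _ lt.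
    rewrite (ltnNge (perm_check tau y)) (ltnW lt) addn0.
    case: qy => // qy; rewrite qy mulnDr muln1 /prec; lia.
  rewrite lt; case: qy => // qy; rewrite qy /prec; lia.
have [dc dE] := DC_potential lab qP.
have dqE : des_at le tau = q by apply/funext.
(* The remainders in the order of [tau]; the shift skips position 0, held by the added minimum. *)
pose z := [ffun j : 'I_n => inord (r (at_pos tau j.+1)) : 'I_m.+1].
have zE x : stair z (perm_check tau x) = r x.
  case: (unliftP ord0 x) => [a ->|->].
    rewrite perm_check_lift lift0 stairS ffunE inordK ?ltnS //.
    by rewrite -lift0 -perm_check_lift at_posK.
  by rewrite perm_check0 stair0 /r N0.
exists tau, z; split => //; last by move=> x; rewrite /alcove_point dqE zE -NE.
apply/staircaseP; rewrite dqE.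
by rewrite (_ : (fun a => _) = r) //; apply/funext.
Qed.

End LatticePoints.

(** * From real points of the dilated hypersimplex to the encoding, and the count *)

Section Hypersimplex.
Variables (R : realType) (n : nat) (le : rel 'I_n) (top : 'I_n) (k m : nat).
Hypotheses (lab : naturally_labeled le) (k_gt0 : (0 < k)%N) (m_gt0 : (0 < m)%N).

(** With f extended by 0 at the added minimum, the bounds at minimal elements become cover
    inequalities like the others. *)
Lemma lipschitz_polytopeP (f : {ffun 'I_n -> R}) :
  lipschitz_polytope le f <->
  forall x y, covers (le_check le) x y -> 0 <= ext0 0 f y - ext0 0 f x <= 1.
Proof.
split=> [[fmin fcov] x y|fP].
  case: (unliftP ord0 y) => [b ->|->]; last by rewrite covers_checkr0.
  case: (unliftP ord0 x) => [a ->|->].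
    by rewrite covers_check_lift !ext0_lift => /fcov.
  by rewrite covers_check0 ext0_lift ext0_0 subr0 => /fmin.
split=> [a|a b].
  by rewrite -(covers_check0 le) => /fP; rewrite ext0_lift ext0_0 subr0.
by rewrite -(covers_check_lift le) => /fP; rewrite !ext0_lift.
Qed.

Lemma lipschitz_polytope_ge0 (f : {ffun 'I_n -> R}) (a : 'I_n) :
  lipschitz_polytope le f -> 0 <= f a.
Proof.
move/lipschitz_polytopeP=> fP.
have [s /andP[ps /eqP ls]] := exists_saturated_chain lab (lift ord0 a).
suff : ext0 0 f ord0 <= ext0 0 f (last ord0 s) by rewrite ls ext0_lift ext0_0.
elim: s ord0 ps {ls} => //= y s IHs x /andP[/fP/andP[+ _] /IHs].
by rewrite subr_ge0; apply: le_trans.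
Qed.

Definition indexed_alcove : pred ('S_n * {ffun 'I_n -> 'I_m.+1}) :=
  [pred p | [&& p.1 \in DC le, des_P le top p.1 == k & p.2 \in alcove le p.1]].

Definition lattice_point (p : 'S_n * {ffun 'I_n -> 'I_m.+1}) : {ffun 'I_n -> R} :=
  [ffun a => (alcove_point le p.1 p.2 (lift ord0 a))%:R].

Lemma ext0_lattice_point p x : p.1 \in DC le ->
  ext0 0 (lattice_point p) x = (alcove_point le p.1 p.2 x)%:R.
Proof.
move=> dc; case: (unliftP ord0 x) => [a|] ->; first by rewrite ext0_lift ffunE.
by rewrite ext0_0 alcove_point0.
Qed.

Lemma lattice_point_inj : {in indexed_alcove &, injective lattice_point}.
Proof.
move=> [tau z] [tau' z'] /and3P[/= dc _ zP] /and3P[/= dc' _ zP'] eqp.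
have [//|-> ->//] := alcove_point_inj lab m_gt0 dc dc' zP zP'.
move=> x; apply/eqP; rewrite -(eqr_nat R).
rewrite -(ext0_lattice_point (p := (tau, z))) //.
by rewrite -(ext0_lattice_point (p := (tau', z'))) // eqp.
Qed.

(* For N > 0, [N.-1 %/ m] is the ceiling of N / m minus one, which is why the  *)
(* slices are open below; at N = 0 it is 0, whence the hypothesis 0 < k.       *)
Lemma des_slice (N : nat) :
  (N.-1 %/ m == k)%N = (k%:R < N%:R / m%:R :> R) && (N%:R / m%:R <= k.+1%:R :> R).
Proof.
have m0 : 0 < m%:R :> R by rewrite ltr0n.
rewrite ltr_pdivlMr // ler_pdivrMr // -!natrM ltr_nat ler_nat.
rewrite eqn_leq leq_divRL // -ltnS ltn_divLR //.
case: N => [|N] /=; last by rewrite andbC ltnS.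
have : (0 < k * m)%N by rewrite muln_gt0 k_gt0.
by move: (k.+1 * m)%N (k * m)%N => a b; lia.
Qed.

Lemma dilate_hypersimplex :
  dilate_lattice_points (half_open_hypersimplex R le top k.+1) m =
  (lattice_point @` [set p | indexed_alcove p])%classic.
Proof.
have m0 : 0 < m%:R :> R by rewrite ltr0n.
apply/seteqP; split=> g /=.
  case=> -[f [fL]]; rewrite -natr1 addrK natr1 => ftop <-{g} fint.
  (* Integral and nonnegative coordinates are natural numbers, so the encoding over [nat]
     applies. *)
  have fnat a : m%:R * f a \is a Num.nat.
    rewrite -intrEge0; first by have := fint a; rewrite ffunE.
    by rewrite mulr_ge0 ?ler0n ?(lipschitz_polytope_ge0 _ fL).
  have [N NE] : {N : 'I_n -> nat | forall a, (N a)%:R = m%:R * f a}.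
    by exists (fun a => Num.truncn (m%:R * f a)) => a; rewrite truncnK.
  pose Nc := ext0 0%N N.
  have NcE x : (Nc x)%:R = m%:R * ext0 0 f x.
    rewrite /Nc; case: (unliftP ord0 x) => [a|] ->.
      by rewrite !ext0_lift NE.
    by rewrite !ext0_0 mulr0.
  have [|x y cxy|tau [z [dc zP zE]]] := @exists_alcove _ _ _ lab m_gt0 Nc.
  - exact: ext0_0.
  - have /andP[] := (lipschitz_polytopeP f).1 fL _ _ cxy.
    rewrite -(ler_pM2l m0) mulr0 -(ler_pM2l m0 _ 1) mulr1 mulrBr -!NcE.
    by rewrite subr_ge0 lerBlDl -natrD !ler_nat => -> ->.
  exists (tau, z) => /=; last first.
    by apply/ffunP => a; rewrite !ffunE zE NcE ext0_lift.
  rewrite /indexed_alcove /= dc zP andbT /des_P -(alcove_point_div _ m_gt0 _ dc zP) // zE.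
  by rewrite des_slice NcE mulrAC mulfV ?gt_eqF // mul1r ext0_lift.
case=> -[tau z] /and3P[/= dc /eqP desk zP] <-{g}; split; last first.
  by move=> a; rewrite ffunE.
exists [ffun a => (m%:R)^-1 * lattice_point (tau, z) a]; last first.
  by apply/ffunP => a; rewrite !ffunE mulVKf ?gt_eqF.
split.
  apply/lipschitz_polytopeP => x y cxy.
  have extE v : ext0 0 [ffun a => (m%:R)^-1 * lattice_point (tau, z) a] v
      = (m%:R)^-1 * (alcove_point le tau z v)%:R.
    rewrite -(ext0_lattice_point (p := (tau, z))) //.
    by case: (unliftP ord0 v) => [a|] ->; rewrite ?ext0_lift ?ffunE // !ext0_0 mulr0.
  rewrite !extE -mulrBr -(ler_pM2l m0) mulr0 -(ler_pM2l m0 _ 1) mulr1 mulVKf ?gt_eqF //.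
  rewrite subr_ge0 lerBlDl -natrD !ler_nat.
  exact: (alcove_point_lipschitz lab m_gt0 dc zP cxy).
rewrite !ffunE -natr1 addrK natr1 mulrC -des_slice /=.
by rewrite alcove_point_div // -desk.
Qed.

Lemma card_indexed_alcove :
  #|indexed_alcove| = (\sum_(tau : 'S_n | (tau \in DC le) && (des_P le top tau == k))
    'C(m + n - Ldes le tau, n))%N.
Proof.
rewrite -sum1_card.
rewrite (eq_bigl (fun p => ((p.1 \in DC le) && (des_P le top p.1 == k)) &&
   (p.2 \in alcove le p.1))); last by move=> p; rewrite !inE andbA.
rewrite -(pair_big_dep (fun tau => (tau \in DC le) && (des_P le top tau == k))
  (fun tau (z : {ffun 'I_n -> 'I_m.+1}) => z \in alcove le tau) (fun _ _ => 1%N)) /=.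
apply: eq_bigr => tau _; rewrite Ldes_steps -card_staircase sum1_card.
by apply: eq_card => z; rewrite !inE.
Qed.

Lemma card_dilate_hypersimplex :
  (dilate_lattice_points (half_open_hypersimplex R le top k.+1) m #=
    `I_(#|indexed_alcove|))%card.
Proof.
rewrite dilate_hypersimplex.
(* Only a default for [nth]; all indices used lie within the enumeration. *)
pose p0 : 'S_n * {ffun 'I_n -> 'I_m.+1} := (1%g, [ffun=> ord0]).
pose F i := lattice_point (nth p0 (enum indexed_alcove) i).
have -> : (lattice_point @` [set p | indexed_alcove p] =
    F @` `I_(#|indexed_alcove|))%classic.
  apply/seteqP; split=> [_ [p pP <-]|_ [i /= lti <-]].
    exists (index p (enum indexed_alcove)); rewrite /F ?nth_index ?mem_enum //=.
    by rewrite cardE index_mem mem_enum.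
  exists (nth p0 (enum indexed_alcove) i) => //=.
  by have := mem_nth p0 (_ : i < size (enum indexed_alcove))%N; rewrite -cardE mem_enum => /(_ lti).
apply: inj_card_eq => i j; rewrite !inE /= cardE => lti ltj /lattice_point_inj eqp.
by apply/eqP; rewrite -(nth_uniq p0 lti ltj (enum_uniq _)) eqp // -mem_enum mem_nth.
Qed.

End Hypersimplex.

Theorem corollary5p7 (R : realType) (n : nat) (le : rel 'I_n) (top : 'I_n)
    (k : nat) :
  naturally_labeled le ->
  (forall a : 'I_n, maximal le a <-> a = top) ->
  (1 <= k < height le)%N ->
  is_hstar (half_open_hypersimplex R le top k.+1)
    (\sum_(tau : 'S_n | (tau \in DC le) && (des_P le top tau == k))
       'X^(Ldes le tau)).
Proof.
move=> lab _ /andP[k_gt0 _].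
(* The Ehrhart polynomial: one binomial polynomial for each half-open simplex of the
   decomposition. *)
exists (\sum_(tau : 'S_n | (tau \in DC le) && (des_P le top tau == k))
  binp R n (Ldes le tau)).
  move=> m m_gt0; exists #|@indexed_alcove n le top k m|.
    exact: card_dilate_hypersimplex.
  rewrite card_indexed_alcove horner_sum natr_sum.
  by apply: eq_bigr => tau _; rewrite horner_binp ?Ldes_le.
move=> j; rewrite coef_sum.
under [RHS]eq_bigr => i _ do rewrite horner_sum mulr_sumr.
rewrite exchange_big; apply: eq_bigr => tau _.
by rewrite coefXn conv_binp ?Ldes_le.
Qed.
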